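(* Let $G=([m],E)$ be a connected undirected graph, let $P_{ii'}>0$ for $\{i,i'\}\in E$ with $\sum_{\{i,i'\}\in E}P_{ii'}=1$, and let $b_1(0),\dots,b_m(0)\in\mathbb{R}^n$ be initial score vectors whose average $\bar b=\frac1m\sum_{i=1}^m b_i(0)$ is ordered: $\bar b^1\le\bar b^2\le\cdots\le\bar b^n$. Let $T$ be the consensus time for the ordering of the gossip process described in the context. Then $$P(T>t)\le 4m\,\lambda_2^t(W)\sum_{j=1}^n\left(\frac{d^j}{r^j}\right)^2,$$ where $W=\sum_{\{i,i'\}\in E}P_{ii'}\left(I-\frac12(e_i-e_{i'})(e_i-e_{i'})^T\right)$, $e_i$ is the $m\times1$ vector with $i$th entry equal to one and all other entries zero, $\lambda_2(W)$ is the second largest eigenvalue of $W$, and $\lambda_2^t(W)=(\lambda_2(W))^t$.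
   Context: Superscripts denote coordinates (objects), subscripts denote agents: $b_i^j(t)$ is the score of agent $i\in[m]$ for object $j\in[n]$ at time $t$, where $[k]=\{1,\dots,k\}$. (For Borda's method, $b_i(0)=\sigma_i^{-1}$, where the permutation $\sigma_i$ of $[n]$ is agent $i$'s ranking, so that $b_i^j(0)=\sigma_i^{-1}(j)$ is the position of object $j$ in it.) Gossip process: at each time $t=0,1,2,\dots$, independently of the past, an edge $\{i,i'\}\in E$ is picked with probability $P_{ii'}$; then $b_i(t+1)=b_{i'}(t+1)=\frac12(b_i(t)+b_{i'}(t))$, and $b_\ell(t+1)=b_\ell(t)$ for $\ell\ne i,i'$. A time $t$ is a consensus time if the ordering of $b_i(t)$ matches the ordering of $\bar b$ for all $i\in[m]$, i.e. $b_i^1(t)\le b_i^2(t)\le\cdots\le b_i^n(t)$ for all $i\in[m]$. The consensus time for the ordering is $T=\min\{t\ge0: t\text{ is a consensus time}\}$. For $j\in[n]$, $r^j=\min\{\bar b^{j+1}-\bar b^j,\ \bar b^j-\bar b^{j-1}\}$, where the undefined term is omitted for $j=1$ and $j=n$, and $d^j=\max_i b_i^j(0)-\min_i b_i^j(0)$. *)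

(* Defs.v *)
From mathcomp Require Import all_boot all_order all_algebra.
From mathcomp Require Import polyrcf.
From mathcomp Require Import all_classical all_reals all_analysis.

Set Implicit Arguments.
Unset Strict Implicit.
Unset Printing Implicit Defensive.

Import Order.TTheory GRing.Theory Num.Theory.
Local Open Scope classical_set_scope.
Local Open Scope ring_scope.

(* An undirected edge {i, i'} is represented by the pair (i, i') with i < i',
   so that a sum over [edges G] counts every edge exactly once. *)
Definition edges (m : nat) (G : rel 'I_m) : {set 'I_m * 'I_m} :=
  [set p : 'I_m * 'I_m | (p.1 < p.2)%N && G p.1 p.2]%SET.

Definition unit_vec (R : pzRingType) (m : nat) (i : 'I_m) : 'cV[R]_m :=
  delta_mx i ord0.

Definition gossip_matrix (R : realType) (m : nat) (G : rel 'I_m)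
    (P : 'I_m * 'I_m -> R) : 'M[R]_m :=
  \sum_(p in edges G) P p *:
    (1%:M - 2^-1 *: ((unit_vec R p.1 - unit_vec R p.2) *m
                     (unit_vec R p.1 - unit_vec R p.2)^T)).

(* The real eigenvalues, repeated according to their multiplicity as roots of
   the characteristic polynomial, in nonincreasing order ([rootsR] lists the
   distinct real roots in increasing order). *)
Definition eigenvalues (R : rcfType) (m : nat) (A : 'M[R]_m) : seq R :=
  rev (flatten [seq nseq (mup a (char_poly A)) a | a <- rootsR (char_poly A)]).

Definition lambda2 (R : rcfType) (m : nat) (A : 'M[R]_m) : R :=
  (eigenvalues A)`_1.

Section Gossip.
Variables (R : realType) (m n : nat).
(* Scores are maps [b : 'I_m -> 'rV[R]_n]: [b i 0 j] is the score of agent [i]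
   for object [j]. *)
Implicit Type b : 'I_m -> 'rV[R]_n.

Definition gossip_step (p : 'I_m * 'I_m) b : 'I_m -> 'rV[R]_n :=
  fun l => if (l == p.1) || (l == p.2) then 2^-1 *: (b p.1 + b p.2) else b l.

Fixpoint gossip b (X : nat -> 'I_m * 'I_m) (t : nat) : 'I_m -> 'rV[R]_n :=
  if t is s.+1 then gossip_step (X s) (gossip b X s) else b.

Definition average b : 'rV[R]_n := m%:R^-1 *: \sum_i b i.

Definition ordered (x : 'rV[R]_n) : Prop :=
  forall j k : 'I_n, (j <= k)%N -> x 0 j <= x 0 k.

Definition is_consensus_time b X (t : nat) : Prop :=
  forall i, ordered (gossip b X t i).

(* The minimum is [+oo] when no time is a consensus time. *)
Definition consensus_time b X : \bar R :=
  ereal_inf [set t%:R%:E | t in [set t | is_consensus_time b X t]].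

(* r^j: each inner minimum ranges over at most one index, and is [+oo], hence
   discarded, when the neighbour j + 1, respectively j - 1, does not exist.
   Being extended real, it can be divided by even when there are ties: d / 0 is
   [+oo] for d > 0, 0 / 0 is 0, and d / +oo is 0. *)
Definition gap (x : 'rV[R]_n) (j : 'I_n) : \bar R :=
  mine (\big[mine/+oo%E]_(k < n | k == j.+1 :> nat) (x 0 k - x 0 j)%:E)
       (\big[mine/+oo%E]_(k < n | j == k.+1 :> nat) (x 0 j - x 0 k)%:E).

(* d^j: for m > 0 the supremum and infimum are a maximum and a minimum. *)
Definition spread b (j : 'I_n) : R :=
  sup (range (fun i => b i 0 j)) - inf (range (fun i => b i 0 j)).

End Gossip.

(* Mutual independence: the product rule over every finite family of indices.
   [S] is finite, and all its subsets are taken as measurable. *)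
Definition mutually_independent (d : measure_display) (T : measurableType d)
    (R : realType) (Pr : probability T R) (S : finType) (X : nat -> T -> S)
    : Prop :=
  forall (J : seq nat) (A : nat -> set S), uniq J ->
    Pr (\bigcap_(k in [set` J]) (X k @^-1` A k)) =
    (\prod_(k <- J) Pr (X k @^-1` A k))%E.

(* Main.v *)
Require Import Defs.
From mathcomp Require Import all_boot all_order all_algebra.
From mathcomp Require Import polyrcf complex.
From mathcomp Require Import all_classical all_reals all_analysis.
From mathcomp Require Import ring lra.

(* The disagreement on object j is the squared norm of the vector of deviations of
   the m scores from their average. Averaging along a random edge preserves the
   average and maps the expected disagreement to the quadratic form of W, which on
   vectors orthogonal to the all-ones vector is at most lambda2(W) times the squared
   norm (spectral theorem). Hence the expected disagreement at time t is at most
   lambda2(W)^t m (d^j)^2. If two neighbouring objects are in the wrong order for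
   some agent, one of them has a deviation above half of its gap, so Markov's
   inequality and a union bound over the objects conclude. Since the process up to
   time t only depends on finitely many edge words, all expectations are finite
   sums over words of length t. *)

Set Implicit Arguments.
Unset Strict Implicit.
Unset Printing Implicit Defensive.

Import Order.TTheory GRing.Theory Num.Theory.
Local Open Scope classical_set_scope.
Local Open Scope ring_scope.

(** * Second eigenvalue of a symmetric matrix *)

(** The blocks of [eigenvalues] belong to distinct roots, so only one block can contain [a]. *)
Lemma count_eigenvalues (R : rcfType) (m : nat) (A : 'M[R]_m) (a : R) :
  count_mem a (eigenvalues A) = mup a (char_poly A).
Proof.
have pN0 : char_poly A != 0 by rewrite monic_neq0 ?char_poly_monic.
rewrite /eigenvalues count_rev count_flatten -map_comp sumnE big_map.
under eq_bigr => c _ do rewrite /= count_nseq /= eq_sym.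
have [ra|Nra] := boolP (a \in rootsR (char_poly A)); last first.
  rewrite big1_seq => [|c /andP[_ cr]].
    rewrite mupNroot//; apply: contra Nra => ra.
    by rewrite -roots_on_rootsR.
  by case: eqP => [ac|//]; rewrite ac cr in Nra.
rewrite (big_rem a)//= eqxx mul1n big1_seq ?addn0// => c /andP[_ cr].
case: eqP => [ac|//]; move: cr; rewrite -ac mem_rem_uniqF//.
by rewrite /rootsR; exact: sorted_uniq lt_trans ltxx _ (sorted_roots _ _ _).
Qed.

Lemma sorted_eigenvalues (R : rcfType) (m : nat) (A : 'M[R]_m) :
  sorted >=%R (eigenvalues A).
Proof.
rewrite /eigenvalues rev_sorted.
have : sorted <=%R (rootsR (char_poly A)).
  by apply: sub_sorted (sorted_roots _ _ _) => x y /ltW.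
rewrite !sorted_pairwise; [|exact: le_trans..].
elim: (rootsR _) => //= a s IHs /andP[/allP a_le /IHs pw_s].
rewrite pairwise_cat pw_s andbT; apply/andP; split.
  apply/allrelP => x y /nseqP[-> _] /flatten_mapP[c cs /nseqP[-> _]].
  exact: a_le.
by elim: (mup _ _) => //= k ->; rewrite all_nseq lexx orbT.
Qed.

Lemma count_gt_lambda2 (R : rcfType) (m : nat) (A : 'M[R]_m) :
  (count (> lambda2 A) (eigenvalues A) <= 1)%N.
Proof.
rewrite /lambda2; have := sorted_eigenvalues A.
(* With fewer than two real eigenvalues [lambda2] is the default 0, but the list is then too short
   to violate the bound. *)
case: (eigenvalues A) => [|a [|c s]] //=; first by rewrite addn0 leq_b1.
move=> /andP[_]; rewrite (path_sortedE (rev_trans le_trans)) => /andP[/allP cs _].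
rewrite ltxx/= add0n -[leqRHS]addn0 leq_add ?leq_b1// leqn0.
by rewrite eqn0Ngt -has_count; apply/hasPn => x /cs /=; rewrite -leNgt.
Qed.

Section Spectral.
Variables (R : rcfType) (m : nat) (W : 'M[R]_m).
Local Notation C := (R[i]).
Local Notation toC := (real_complex R).
Local Notation "M ^t*" := (map_mx Num.conj M^T) (at level 30).
Local Notation "M ^C" := (map_mx toC M) (at level 1, format "M ^C").

(** Over [R[i]] the matrix is Hermitian, hence unitarily diagonalizable with a real diagonal, which
    descends to [R]. *)
Lemma real_symmetric_spectral : W^T = W ->
  exists2 U : 'M[C]_m, U \is spectral.unitarymx &
  exists r : 'I_m -> R,
    W^C = invmx U *m diag_mx (\row_i toC (r i)) *m U.
Proof.
move=> Wsym.
have Wherm : W^C \is hermsymmx.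
  apply: spectral.realsym_hermsym.
    by apply/is_hermitianmxP; rewrite expr0 scale1r map_mx_id// map_trmx Wsym.
  by apply/mxOverP => i j; rewrite mxE complex_real.
have /mxOverP Dreal := spectral.hermitian_spectral_diag_real Wherm.
exists (spectral.spectralmx W^C); first exact: spectral.spectral_unitarymx.
exists (fun i => complex.Re (spectral.spectral_diag W^C 0 i)).
have -> : \row_i toC (complex.Re (spectral.spectral_diag W^C 0 i)) =
          spectral.spectral_diag W^C.
  by apply/rowP => i; rewrite mxE RRe_real.
exact/spectral.orthomx_spectralP/spectral.hermitian_normalmx.
Qed.

Variables (U : 'M[C]_m) (r : 'I_m -> R).
Hypothesis U_unitary : U \is spectral.unitarymx.
Hypothesis W_diag : W^C = invmx U *m diag_mx (\row_i toC (r i)) *m U.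

Lemma char_poly_spectral : char_poly W = \prod_i ('X - (r i)%:P).
Proof.
have U_unit := spectral.unitarymx_unit U_unitary.
apply: (map_poly_inj toC); rewrite map_char_poly W_diag rmorph_prod.
transitivity (char_poly (diag_mx (\row_i toC (r i)))); last first.
  rewrite char_poly_trig ?diag_mx_is_trig//; apply: eq_bigr => i _.
  by rewrite !mxE eqxx mulr1n rmorphB/= map_polyX map_polyC.
set D := diag_mx _; rewrite /char_poly.
have KV : map_mx polyC (invmx U) *m map_mx polyC U = 1%:M.
  by rewrite -map_mxM mulVmx// map_mx1.
have -> : char_poly_mx (invmx U *m D *m U) =
    map_mx polyC (invmx U) *m char_poly_mx D *m map_mx polyC U.
  rewrite /char_poly_mx !map_mxM mulmxBr mulmxBl; congr (_ - _).
  by rewrite scalar_mxC -mulmxA KV mulmx1.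
by rewrite !det_mulmx mulrAC -det_mulmx KV det1 mul1r.
Qed.

(** Carries facts about the sorted list, such as [count_gt_lambda2], over to the indices of the
    eigenbasis. *)
Lemma perm_eigenvalues_spectral : perm_eq (eigenvalues W) (codom r).
Proof.
apply/allP => a _ /=; rewrite count_eigenvalues char_poly_spectral.
by rewrite -(big_image _ _ r xpredT (fun x => 'X - x%:P)) mu_prod_XsubC.
Qed.

(** The coordinates of [x] in the orthonormal basis of left eigenvectors of [W] given by the rows of
    [U]. *)
Definition spectral_coord (x : 'rV[R]_m) : 'rV[C]_m := x^C *m U^t*.

(** Parseval's identity: [U^t*] and [U] cancel in the middle of the product. *)
Lemma spectral_coord_dot (x y : 'rV[R]_m) :
  toC ((x *m y^T) 0 0) =
  \sum_i spectral_coord x 0 i * (spectral_coord y 0 i)^*.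
Proof.
have -> : \sum_i spectral_coord x 0 i * (spectral_coord y 0 i)^* =
    (spectral_coord x *m (spectral_coord y)^t*) 0 0.
  by rewrite [RHS]mxE; apply: eq_bigr => i _; rewrite !mxE.
have -> : (spectral_coord y)^t* = U *m y^C^T.
  rewrite /spectral_coord trmx_mul map_mxM; congr (_ *m _).
    by apply/matrixP => i j; rewrite !mxE; exact: conjCK.
  by apply/matrixP => i j; rewrite !mxE; exact: conjc_real.
rewrite /spectral_coord mulmxA -(mulmxA _ _ U) -spectral.invmx_unitary//.
by rewrite mulVmx ?spectral.unitarymx_unit// mulmx1 map_trmx -map_mxM [RHS]mxE.
Qed.

Lemma spectral_coord_mul (x : 'rV[R]_m) i :
  spectral_coord (x *m W) 0 i = toC (r i) * spectral_coord x 0 i.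
Proof.
rewrite /spectral_coord map_mxM W_diag -spectral.invmx_unitary// !mulmxA.
rewrite mulmxK ?spectral.unitarymx_unit// mul_mx_diag mxE mulrC.
by congr (_ * _); rewrite mxE.
Qed.

End Spectral.

Lemma normsq_row (R : realDomainType) (m : nat) (x : 'rV[R]_m) :
  (x *m x^T) 0 0 = \sum_i x 0 i ^+ 2.
Proof. by rewrite mxE; apply: eq_bigr => i _; rewrite mxE expr2. Qed.

Lemma normsq_row_ge0 (R : realDomainType) (m : nat) (x : 'rV[R]_m) :
  0 <= (x *m x^T) 0 0.
Proof. by rewrite normsq_row sumr_ge0// => i _; exact: sqr_ge0. Qed.

Lemma normsq_row_eq0 (R : realDomainType) (m : nat) (x : 'rV[R]_m) :
  ((x *m x^T) 0 0 == 0) = (x == 0).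
Proof.
rewrite normsq_row psumr_eq0 => [|i _]; last exact: sqr_ge0.
apply/allP/eqP => [x0|-> i _]; last by rewrite /= mxE expr0n eqxx.
apply/rowP => i; apply/eqP; rewrite mxE -sqrf_eq0.
exact: x0 (mem_index_enum i).
Qed.

Section Rayleigh.
Variables (R : rcfType) (m : nat) (W : 'M[R]_m).
Hypotheses (m_gt1 : (1 < m)%N) (Wsym : W^T = W).

(** As [1 < m], index 1 lies inside the list, so [lambda2 W] is a genuine eigenvalue; the form is
    then evaluated at an eigenvector. *)
Lemma lambda2_ge0 :
  (forall x : 'rV[R]_m, 0 <= (x *m W *m x^T) 0 0) -> 0 <= lambda2 W.
Proof.
move=> W_ge0.
have [U U_unitary [r W_diag]] := real_symmetric_spectral Wsym.
have perm_r := perm_eigenvalues_spectral U_unitary W_diag.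
have : lambda2 W \in eigenvalues W.
  by rewrite mem_nth// (perm_size perm_r) size_codom card_ord.
rewrite -has_pred1 has_count count_eigenvalues.
rewrite -XsubC_dvd ?monic_neq0 ?char_poly_monic// dvdp_XsubCl.
rewrite -eigenvalue_root_char => /eigenvalueP[v vW v0].
have := W_ge0 v; rewrite vW -scalemxAl mxE pmulr_lge0//.
by rewrite lt_neqAle eq_sym normsq_row_eq0 v0 normsq_row_ge0.
Qed.

(* If lambda2 >= 1 the bound is that of a contraction. Otherwise the eigenvalue 1 is
   simple, so orthogonality to [v] kills the top coordinate of [x]. *)
Lemma rayleigh_lambda2 (v x : 'rV[R]_m) :
  (forall y : 'rV[R]_m, (y *m W *m y^T) 0 0 <= (y *m y^T) 0 0) ->
  v != 0 -> v *m W = v -> x *m v^T = 0 ->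
  (x *m W *m x^T) 0 0 <= lambda2 W * (x *m x^T) 0 0.
Proof.
move=> W_le1 v0 vW xv0.
have [lambda_ge1|lambda_lt1] := leP 1 (lambda2 W).
  by rewrite (le_trans (W_le1 x))// ler_peMl ?normsq_row_ge0.
have [U U_unitary [r W_diag]] := real_symmetric_spectral Wsym.
have perm_r := perm_eigenvalues_spectral U_unitary W_diag.
(* At most one index carries an eigenvalue above [lambda2 W]; if none does, any index serves as
   [i0]. *)
have [i0 r_le] : exists i0, forall i, i != i0 -> r i <= lambda2 W.
  have := count_gt_lambda2 W; rewrite (permP perm_r) count_map.
  rewrite -size_filter enumT => size_le1.
  have card_le1 : (#|[pred i | (lambda2 W < r i)%R]| <= 1)%N.
    by rewrite cardE; exact: size_le1.
  case: (pickP [pred i | lambda2 W < r i]) => [i0 ri0|none].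
    exists i0 => i; rewrite leNgt; apply: contra => ri.
    by rewrite (card_le1_eqP card_le1 i i0).
  by exists (Ordinal m_gt1) => i _; rewrite leNgt; have /= -> := none i.
pose c := spectral_coord U.
have cW y i : c (y *m W) 0 i = (r i)%:C%C * c y 0 i.
  exact: spectral_coord_mul.
have c_dot (y z : 'rV[R]_m) :
    ((y *m z^T) 0 0)%:C%C = \sum_i c y 0 i * (c z 0 i)^*.
  exact: spectral_coord_dot.
(* A nonzero coordinate of [v] at [i] would force [r i = 1], above [lambda2 W]. So [v] lives on [i0]
   alone. *)
have cv0 i : i != i0 -> c v 0 i = 0.
  move=> /r_le ri; have /eqP := cW v i.
  rewrite vW -subr_eq0 -{1}[c v 0 i]mul1r -mulrBl mulf_eq0 => /orP[|/eqP//].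
  rewrite -(rmorph1 (real_complex R)) -rmorphB/= fmorph_eq0 subr_eq0 => /eqP r1.
  by rewrite -r1 leNgt lambda_lt1 in ri.
have cvi0 : c v 0 i0 != 0.
  apply: contra v0 => /eqP cvi0; rewrite -normsq_row_eq0.
  rewrite -(fmorph_eq0 (real_complex R)) /= c_dot big1// => i _.
  by have [->|/cv0->] := eqVneq i i0; rewrite ?cvi0 mul0r.
have cx0 : c x 0 i0 = 0.
  have := c_dot x v; rewrite xv0 mxE (bigD1 i0)//= big1 => [|i /cv0->].
    move=> /esym/eqP; rewrite addr0 mulf_eq0 => /orP[/eqP//|].
    by rewrite fmorph_eq0 (negPf cvi0).
  by rewrite rmorph0 mulr0.
rewrite -lecR rmorphM/= !c_dot mulr_sumr ler_sum// => i _.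
rewrite cW -mulrA.
have [->|/r_le ri] := eqVneq i i0; first by rewrite cx0 !(mul0r, mulr0).
by rewrite ler_wpM2r ?lecR// mul_conjC_ge0.
Qed.

End Rayleigh.

(** * Expected disagreement after one step *)

Section GossipMatrix.
Variables (R : realType) (m : nat) (G : rel 'I_m) (P : 'I_m * 'I_m -> R).
Hypothesis Psum : \sum_(p in edges G) P p = 1.
Local Notation W := (gossip_matrix G P).

Lemma trmx_gossip_matrix : W^T = W.
Proof.
rewrite /gossip_matrix raddf_sum; apply: eq_bigr => p _ /=.
by rewrite linearZ/= linearB/= linearZ/= trmx_mul trmxK trmx1.
Qed.

Lemma mul_row_unit_diff (x : 'rV[R]_m) (i j : 'I_m) :
  (x *m (unit_vec R i - unit_vec R j)) 0 0 = x 0 i - x 0 j.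
Proof. by rewrite mulmxBr -!colE !mxE. Qed.

(** Link to the process: at a deviation vector, the factor of [P p] is the disagreement left after
    averaging along [p]. *)
Lemma gossip_matrix_quad (x : 'rV[R]_m) :
  (x *m W *m x^T) 0 0 = \sum_(p in edges G)
    P p * ((x *m x^T) 0 0 - 2^-1 * (x 0 p.1 - x 0 p.2) ^+ 2).
Proof.
have entryE (A B : 'M[R]_1) c : (A - c *: B) 0 0 = A 0 0 - c * B 0 0.
  by rewrite !mxE.
rewrite mulmx_sumr mulmx_suml summxE; apply: eq_bigr => p _.
rewrite -scalemxAr -scalemxAl [LHS]mxE; congr (_ * _).
set u := unit_vec R p.1 - _.
have -> : x *m (1%:M - 2^-1 *: (u *m u^T)) *m x^T =
    x *m x^T - 2^-1 *: ((x *m u) *m (x *m u)^T).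
  by rewrite mulmxBr mulmx1 mulmxBl -scalemxAr -scalemxAl trmx_mul !mulmxA.
by rewrite entryE [X in _ * X]normsq_row big_ord1 mul_row_unit_diff.
Qed.

(** Supplies the eigenvector of eigenvalue 1 to which deviations are orthogonal; differences of unit
    vectors annihilate constants. *)
Lemma gossip_matrix_const : const_mx 1 *m W = const_mx 1 :> 'rV[R]_m.
Proof.
transitivity ((\sum_(p in edges G) P p) *: const_mx 1 : 'rV[R]_m); last first.
  by rewrite Psum scale1r.
rewrite mulmx_sumr scaler_suml; apply: eq_bigr => p _.
rewrite -scalemxAr mulmxBr mulmx1 -scalemxAr mulmxA.
suff -> : const_mx 1 *m (unit_vec R p.1 - unit_vec R p.2) = 0 :> 'rV[R]_1.
  by rewrite mul0mx scaler0 subr0.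
by apply/rowP => i; rewrite ord1 mul_row_unit_diff !mxE subrr.
Qed.

Hypothesis Ppos : forall p, p \in edges G -> 0 < P p.

Lemma gossip_matrix_contraction (x : 'rV[R]_m) :
  (x *m W *m x^T) 0 0 <= (x *m x^T) 0 0.
Proof.
rewrite gossip_matrix_quad -[leRHS]mul1r -[X in _ <= X * _]Psum mulr_suml.
apply: ler_sum => p /Ppos/ltW p0; rewrite ler_wpM2l// lerBlDr lerDl.
by rewrite mulr_ge0 ?sqr_ge0// invr_ge0.
Qed.

Lemma gossip_matrix_ge0 (x : 'rV[R]_m) : 0 <= (x *m W *m x^T) 0 0.
Proof.
rewrite gossip_matrix_quad; apply: sumr_ge0 => p pG.
rewrite mulr_ge0 ?(ltW (Ppos pG))// normsq_row.
have p12 : p.2 != p.1.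
  move: pG; rewrite inE => /andP[/ltn_eqF/eqP p12 _].
  by apply/eqP => /esym/(congr1 val).
rewrite (bigD1 p.1)//= (bigD1 p.2)//=.
have : 0 <= \sum_(i < m | (i != p.1) && (i != p.2)) x 0 i ^+ 2.
  by apply: sumr_ge0 => i _; exact: sqr_ge0.
(* With [u] and [v] the two entries, [u^2 + v^2 - (u - v)^2 / 2 = (u + v)^2 / 2]. *)
have := sqr_ge0 (x 0 p.1 + x 0 p.2).
by set S := \sum_(i < m | _) _; nra.
Qed.

End GossipMatrix.

Section GossipStep.
Variables (R : realType) (m n : nat).
Implicit Type b : 'I_m -> 'rV[R]_n.

(** [F] is arbitrary so as to cover both the average ([id]) and the disagreement (squared
    deviations). *)
Lemma sum_gossip_step (V : zmodType) (F : 'rV[R]_n -> V) p b : p.2 != p.1 ->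
  \sum_i F (gossip_step p b i) =
  \sum_i F (b i) - (F (b p.1) + F (b p.2)) + F (2^-1 *: (b p.1 + b p.2)) *+ 2.
Proof.
move=> p12; rewrite (bigD1 p.1)//= (bigD1 p.2)//=.
rewrite [in RHS](bigD1 p.1)//= [in RHS](bigD1 p.2)//=.
rewrite /gossip_step !eqxx/= orbT.
rewrite (eq_bigr (fun i => F (b i))) => [|i /andP[/negPf-> /negPf->]//].
by rewrite [X in _ = X - _ + _]addrA [X in _ = X - _ + _]addrC addrK mulr2n addrA addrC.
Qed.

Lemma average_gossip_step p b : p.2 != p.1 ->
  average (gossip_step p b) = average b.
Proof.
have half2 : 2^-1 *+ 2 = 1 :> R by rewrite -[LHS]mulr_natr mulVf ?pnatr_eq0.
move=> p12; rewrite /average (sum_gossip_step id)// scalerMnl half2.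
by rewrite scale1r subrK.
Qed.

Definition deviation b j : 'rV[R]_m := \row_i (b i 0 j - average b 0 j).

Definition disagreement b j : R := (deviation b j *m (deviation b j)^T) 0 0.

Lemma disagreementE b j :
  disagreement b j = \sum_i (b i 0 j - average b 0 j) ^+ 2.
Proof. by rewrite /disagreement normsq_row; apply: eq_bigr => i _; rewrite mxE. Qed.

Lemma disagreement_ge0 b j : 0 <= disagreement b j.
Proof. exact: normsq_row_ge0. Qed.

Lemma disagreement_gossip_step p b j : p.2 != p.1 ->
  disagreement (gossip_step p b) j =
  disagreement b j - 2^-1 * (deviation b j 0 p.1 - deviation b j 0 p.2) ^+ 2.
Proof.
move=> p12; rewrite !disagreementE average_gossip_step//.
rewrite (sum_gossip_step (fun x => (x 0 j - average b 0 j) ^+ 2))//.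
rewrite /deviation [X in _ * (X - _) ^+ 2]mxE [X in _ * (_ - X) ^+ 2]mxE.
by move: (average b 0 j) => a; rewrite !mxE; field.
Qed.

Lemma sum_deviation b j : deviation b j *m (const_mx 1 : 'rV[R]_m)^T = 0.
Proof.
apply/rowP => k; rewrite ord1 !mxE.
transitivity (\sum_i (b i 0 j - average b 0 j)).
  by apply: eq_bigr => i _; rewrite !mxE mulr1.
rewrite sumrB sumr_const card_ord -mulr_natl.
have [m0|m0] := eqVneq (m%:R : R) 0.
  rewrite m0 mul0r subr0 big1// => i _.
  move/eqP: m0; rewrite pnatr_eq0 => m0.
  by have := leq_ltn_trans (leq0n i) (ltn_ord i); rewrite lt0n m0.
by rewrite !mxE mulrA mulfV// mul1r summxE subrr.
Qed.

Lemma expected_disagreement_step (G : rel 'I_m) (P : 'I_m * 'I_m -> R) b j :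
  (1 < m)%N -> (forall p, p \in edges G -> 0 < P p) ->
  \sum_(p in edges G) P p = 1 ->
  \sum_(p in edges G) P p * disagreement (gossip_step p b) j <=
  lambda2 (gossip_matrix G P) * disagreement b j.
Proof.
move=> m_gt1 Ppos Psum.
rewrite (eq_bigr (fun p => P p * ((deviation b j *m (deviation b j)^T) 0 0 -
    2^-1 * (deviation b j 0 p.1 - deviation b j 0 p.2) ^+ 2))); last first.
  move=> p; rewrite inE => /andP[/ltn_eqF/eqP p12 _].
  by rewrite disagreement_gossip_step//; apply/eqP => /esym/(congr1 val).
rewrite -gossip_matrix_quad.
apply: (@rayleigh_lambda2 _ _ _ m_gt1 _ (const_mx 1)).
- exact: trmx_gossip_matrix.
- exact: gossip_matrix_contraction.
- apply/eqP => /rowP /(_ (Ordinal m_gt1)); rewrite !mxE => /eqP.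
  by rewrite oner_eq0.
- exact: gossip_matrix_const.
- exact: sum_deviation.
Qed.

End GossipStep.

(** * Words of edges *)

(** Words grow at their end, where the latest edge stands, so that induction on [t] splits off the
    last gossip step. *)
Fixpoint words (S : finType) (t : nat) : seq (seq S) :=
  if t is t'.+1 then [seq rcons u p | u <- words S t', p <- enum S]
  else [:: [::]].

Lemma mem_words (S : finType) (t : nat) (u : seq S) :
  (u \in words S t) = (size u == t).
Proof.
elim: t u => [|t IHt] u /=; first by rewrite inE size_eq0.
apply/allpairsP/idP => [[[v p] /= [vt _ ->]]|].
  by rewrite size_rcons eqSS -IHt.
case/lastP: u => // v p; rewrite size_rcons eqSS -IHt => vt.
by exists (v, p); rewrite mem_enum.
Qed.

Lemma gossip_eq (R : realType) (m n : nat) (b : 'I_m -> 'rV[R]_n) X Y t :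
  (forall s, (s < t)%N -> X s = Y s) -> gossip b X t = gossip b Y t.
Proof.
elim: t => //= t IHt XY.
by rewrite (XY t)// IHt// => s st; apply: XY; exact: ltnW.
Qed.

Section Words.
Variables (R : realType) (m n : nat) (G : rel 'I_m) (P : 'I_m * 'I_m -> R).
Hypotheses (m_gt1 : (1 < m)%N) (Ppos : forall p, p \in edges G -> 0 < P p).
Hypothesis Psum : \sum_(p in edges G) P p = 1.
Variables (b : 'I_m -> 'rV[R]_n) (p0 : 'I_m * 'I_m).

(** Extending [P] by 0 lets words range over all pairs; those containing a non-edge get weight 0. *)
Definition edge_law (p : 'I_m * 'I_m) : R := if p \in edges G then P p else 0.

Lemma edge_law_ge0 p : 0 <= edge_law p.
Proof. by rewrite /edge_law; case: ifP => // /Ppos/ltW. Qed.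

Definition word_law (u : seq ('I_m * 'I_m)) : R := \prod_(p <- u) edge_law p.

Lemma word_law_ge0 u : 0 <= word_law u.
Proof. by apply: prodr_ge0 => p _; exact: edge_law_ge0. Qed.

Lemma lambda2_gossip_ge0 : 0 <= lambda2 (gossip_matrix G P).
Proof.
apply: (@lambda2_ge0 _ _ _ m_gt1); first exact: trmx_gossip_matrix.
by move=> x; exact: gossip_matrix_ge0.
Qed.

Lemma expected_disagreement t j :
  \sum_(u <- words _ t) word_law u * disagreement (gossip b (nth p0 u) t) j
  <= lambda2 (gossip_matrix G P) ^+ t * disagreement b j.
Proof.
elim: t => [|t IHt].
  by rewrite /= big_seq1 expr0 /word_law big_nil.
rewrite exprS -mulrA.
apply: le_trans (ler_wpM2l lambda2_gossip_ge0 IHt); rewrite mulr_sumr.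
rewrite [words _ _]/= big_allpairs_dep big_seq [leRHS]big_seq; apply: ler_sum => u.
rewrite mem_words => /eqP ut.
rewrite mulrCA; set c := gossip b (nth p0 u) t.
(* The past [u] is fixed, and the one-step bound averages over the next edge. *)
apply: le_trans (ler_wpM2l (word_law_ge0 u)
  (expected_disagreement_step c j m_gt1 Ppos Psum)).
rewrite mulr_sumr [leRHS]big_mkcond big_enum/=; apply: ler_sum => p _.
rewrite /word_law -cats1 big_cat big_seq1 nth_cat ut ltnn subnn/=.
rewrite (@gossip_eq _ _ _ _ _ (nth p0 u)) => [|s st]; last first.
  by rewrite nth_cat ut st.
by rewrite -mulrA /edge_law; case: ifP => _; rewrite ?(mul0r, mulr0).
Qed.

Lemma average_gossip X t :
  (forall s, (s < t)%N -> X s \in edges G) -> average (gossip b X t) = average b.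
Proof.
elim: t => //= t IHt XG; rewrite average_gossip_step.
  by apply: IHt => s st; apply: XG; exact: ltnW.
have := XG t (ltnSn t); rewrite inE => /andP[/ltn_eqF/eqP p12 _].
by apply/eqP => /esym/(congr1 val).
Qed.

End Words.

(** * Swapped neighbours and gaps *)

Section Order.
Variables (R : realType) (n : nat).
Implicit Types x a : 'rV[R]_n.

(** Otherwise all adjacent pairs are in order, and induction on [k - j] chains them. *)
Lemma not_ordered x :
  ~ ordered x -> exists j k : 'I_n, k = j.+1 :> nat /\ x 0 k < x 0 j.
Proof.
move=> Nx; apply: contrapT => /forallNP H; apply: Nx => j k.
have step (i l : 'I_n) : l = i.+1 :> nat -> x 0 i <= x 0 l.
  move=> li; rewrite leNgt; apply/negP => lt.
  by have /forallNP/(_ l) := H i; apply.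
have [d] := ubnP (k - j)%N; elim: d k => // d IHd k kd.
rewrite leq_eqVlt => /orP[/eqP/val_inj->//|jk].
have k1n : (k.-1 < n)%N by rewrite (leq_ltn_trans (leq_pred k)).
have k1 : k = k.-1.+1 :> nat by rewrite prednK// (leq_trans _ jk).
apply: le_trans (step (Ordinal k1n) k k1); apply: IHd => /=.
  by rewrite -ltnS (leq_trans _ kd)// ltnS [in leqRHS]k1 subSn// -ltnS -k1.
by rewrite -ltnS -k1.
Qed.

Lemma gap_ge0 a j : ordered a -> (0 <= gap a j)%E.
Proof.
move=> ord_a; rewrite /gap le_min; apply/andP; split.
  apply: (big_ind (fun y => 0 <= y)%E) => // [y z y0 z0|k /eqP kj].
    by rewrite le_min y0.
  by rewrite lee_fin subr_ge0 ord_a// kj.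
apply: (big_ind (fun y => 0 <= y)%E) => // [y z y0 z0|k /eqP kj].
  by rewrite le_min y0.
by rewrite lee_fin subr_ge0 ord_a// kj.
Qed.

Lemma gap_le_next a (j k : 'I_n) : k = j.+1 :> nat ->
  (gap a j <= (a 0 k - a 0 j)%:E)%E.
Proof.
move=> kj; rewrite /gap ge_min; apply/orP; left.
by apply: bigmin_le_cond; rewrite kj.
Qed.

Lemma gap_le_prev a (j k : 'I_n) : k = j.+1 :> nat ->
  (gap a k <= (a 0 k - a 0 j)%:E)%E.
Proof.
move=> kj; rewrite /gap ge_min; apply/orP; right.
by apply: bigmin_le_cond; rewrite kj.
Qed.

(* If neighbours j and j + 1 are swapped, one of them deviates by more than half
   of their distance, which is at least its gap. *)
Lemma not_ordered_deviation x a : ordered a -> ~ ordered x ->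
  exists j g, [/\ gap a j = g%:E, 0 <= g & g ^+ 2 < 4 * (x 0 j - a 0 j) ^+ 2].
Proof.
move=> ord_a /not_ordered[j [k [kj xkj]]].
(* A gap bounded by a real is itself real, being nonnegative. *)
have gapE l (e : R) : (gap a l <= e%:E)%E -> 
    exists g, [/\ gap a l = g%:E, 0 <= g & g <= e].
  have := gap_ge0 l ord_a.
  by case: (gap a l) => [g| |]//; rewrite !lee_fin => g0 ge; exists g.
have [gj [gapj gj0 gj_le]] := gapE _ _ (gap_le_next a kj).
have [gk [gapk gk0 gk_le]] := gapE _ _ (gap_le_prev a kj).
have [lt_j|ge_j] := ltP gj (2 * (x 0 j - a 0 j)).
  by exists j, gj; split => //; nra.
exists k, gk; split => //.
(* [2 (x k - a k) < 2 (x j - a j) - 2 (a k - a j) <= - (a k - a j) <= - gk]. *)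
have : gk < - (2 * (x 0 k - a 0 k)) by lra.
by nra.
Qed.

End Order.

(** * Initial disagreement and spread *)

Section Spread.
Variables (R : realType) (m n : nat) (b : 'I_m -> 'rV[R]_n).

Lemma spread_ge i k j : b i 0 j - b k 0 j <= spread b j.
Proof.
(* A common bound on the scores, so that [sup] and [inf] in [spread] are genuine. *)
have bnd l : `|b l 0 j| <= \sum_i `|b i 0 j|.
  by rewrite (bigD1 l)//= lerDl sumr_ge0.
rewrite /spread lerB//.
  apply: ub_le_sup; last by exists i.
  exists (\sum_i `|b i 0 j|) => _ [l _ <-].
  exact: le_trans (ler_norm _) (bnd l).
apply: ge_inf; last by exists k.
exists (- \sum_i `|b i 0 j|) => _ [l _ <-].
by rewrite lerNl; apply: le_trans (bnd l); rewrite -normrN ler_norm.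
Qed.

Hypothesis m_gt0 : (0 < m)%N.

Lemma spread_ge0 j : 0 <= spread b j.
Proof. by have := spread_ge (Ordinal m_gt0) (Ordinal m_gt0) j; rewrite subrr. Qed.

Lemma disagreement_le_spread j :
  disagreement b j <= m%:R * spread b j ^+ 2.
Proof.
have mR : 0 < m%:R :> R by rewrite ltr0n.
(* The deviation of a value from the mean is the mean of its differences with all values. Scores and
   their opposites give the two sides of the absolute value. *)
have dev_le (s : R) (c : 'I_m -> R) i : (forall k, c i - c k <= s) ->
    c i - m%:R^-1 * \sum_k c k <= s.
  move=> cs; rewrite -(ler_pM2l mR) mulrBr mulrA mulfV ?gt_eqF// mul1r.
  have : \sum_(k < m) (c i - c k) <= \sum_(k < m) s by exact: ler_sum.
  by rewrite sumrB !sumr_const card_ord !mulr_natl.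
rewrite disagreementE mulr_natl.
have -> : spread b j ^+ 2 *+ m = \sum_(i < m) spread b j ^+ 2.
  by rewrite sumr_const card_ord.
apply: ler_sum => i _; rewrite -real_normK ?num_real// lerXn2r ?nnegrE ?spread_ge0//.
have -> : average b 0 j = m%:R^-1 * \sum_k b k 0 j by rewrite !mxE summxE.
rewrite ler_norml; apply/andP; split.
  have : - b i 0 j - m%:R^-1 * \sum_k - b k 0 j <= spread b j.
    apply: (dev_le _ (fun k => - b k 0 j)) => k.
    by rewrite opprK addrC; exact: spread_ge.
  by rewrite sumrN mulrN opprK addrC lerNl opprB.
by apply: (dev_le _ (fun k => b k 0 j)) => k; exact: spread_ge.
Qed.

End Spread.

(** * Law of the process *)

Lemma consensus_time_gt (R : realType) (m n : nat) (b : 'I_m -> 'rV[R]_n) X t :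
  (t%:R%:E < consensus_time b X)%E <->
  forall s, (s <= t)%N -> ~ is_consensus_time b X s.
Proof.
split => [tT s st cs|no_cs].
  have : (consensus_time b X <= s%:R%:E)%E.
    by apply: ereal_inf_lbound; exists s.
  by move=> /(lt_le_trans tT); rewrite lte_fin ltr_nat ltnNge st.
(* Consensus times are integers, so those after [t] are bounded below by [t + 1], and so is their
   infimum. *)
apply: (@lt_le_trans _ _ (t.+1%:R%:E)); first by rewrite lte_fin ltr_nat.
apply: le_ereal_inf_tmp => _ [s cs <-]; rewrite lee_fin ler_nat ltnNge.
by apply/negP => /no_cs.
Qed.

Section Measure.
Variables (R : realType) (d : measure_display) (T : measurableType d).
Variable Pr : probability T R.

Lemma measure_bigsetU_le (I : Type) (s : seq I) (B : pred I) (F : I -> set T) :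
  (forall i, measurable (F i)) ->
  (Pr (\big[setU/set0]_(i <- s | B i) F i) <= \sum_(i <- s | B i) Pr (F i))%E.
Proof.
move=> mF; elim: s => [|i s IHs]; first by rewrite !big_nil measure0.
rewrite !big_cons; case: ifP => // _.
apply: le_trans (leeD2l _ IHs); apply: measureU2 => //.
exact: bigsetU_measurable.
Qed.

Variables (S : finType) (Y : T -> S).
Hypothesis Ymeas : forall p, measurable (Y @^-1` [set p]).

Lemma sum_law_le1 (s : seq S) : uniq s ->
  (\sum_(p <- s) Pr (Y @^-1` [set p]) <= 1)%E.
Proof.
move=> s_uniq.
suff <- : Pr (\big[setU/set0]_(p <- s) (Y @^-1` [set p])) =
    (\sum_(p <- s) Pr (Y @^-1` [set p]))%E.
  by apply: probability_le1; apply: bigsetU_measurable => p _; exact: Ymeas.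
elim: s s_uniq => [|p s IHs] /=; first by rewrite !big_nil measure0.
case/andP=> ps /IHs {}IHs; rewrite !big_cons -IHs.
apply: measureU; first exact: Ymeas.
  by apply: bigsetU_measurable => q _; exact: Ymeas.
rewrite -bigcup_seq; apply/seteqP; split => // w [/= Yp [q /= qs Yq]].
by move: ps; rewrite -Yp Yq qs.
Qed.

End Measure.

Section Law.
Variables (R : realType) (m : nat) (G : rel 'I_m) (P : 'I_m * 'I_m -> R).
Hypothesis Psum : \sum_(p in edges G) P p = 1.
Variables (d : measure_display) (T : measurableType d) (Pr : probability T R).
Variable X : nat -> T -> 'I_m * 'I_m.
Hypothesis Xmeas : forall s p, measurable (X s @^-1` [set p]).
Hypothesis Xlaw :
  forall s p, p \in edges G -> Pr (X s @^-1` [set p]) = (P p)%:E.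
Hypothesis Xind : mutually_independent Pr X.

(** The edges already have total mass 1, so by [sum_law_le1] any other pair has probability 0. *)
Lemma edge_lawE s p : Pr (X s @^-1` [set p]) = (edge_law G P p)%:E.
Proof.
rewrite /edge_law; case: ifPn => [|pG]; first exact: Xlaw.
have := @sum_law_le1 _ _ _ Pr _ _ (Xmeas s) (p :: enum (edges G)).
rewrite /= mem_enum pG enum_uniq big_cons big_enum/= => /(_ isT).
rewrite (eq_bigr (fun q => (P q)%:E)) => [|q]; last exact: Xlaw.
rewrite sumEFin Psum => le1; apply/eqP; rewrite eq_le measure_ge0 andbT.
by rewrite -(leeD2rE _ _ (isT : 1%:E \is a fin_num)) add0e.
Qed.

(** An intersection over a duplicate-free list of times, the shape of [mutually_independent]. The
    default [p0] is never read, as [k < size u]. *)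
Definition cylinder p0 (u : seq ('I_m * 'I_m)) : set T :=
  \bigcap_(k in [set` iota 0 (size u)]) (X k @^-1` [set nth p0 u k]).

Lemma measurable_cylinder p0 u : measurable (cylinder p0 u).
Proof. exact: fin_bigcap_measurable. Qed.

Lemma law_cylinder p0 u : Pr (cylinder p0 u) = (word_law G P u)%:E.
Proof.
rewrite /cylinder (@Xind (iota 0 (size u)) (fun k => [set nth p0 u k])) ?iota_uniq//.
under eq_bigr => k _ do rewrite edge_lawE.
rewrite prodEFin /word_law [in RHS](big_nth p0) /index_iota subn0.
by [].
Qed.

(** An event decided by the first [t] picks becomes a finite union of cylinders. [nth p0 u] pads [u]
    with [p0] from time [t] on, which [B] cannot see. *)
Lemma bigsetU_cylinder p0 t (B : (nat -> 'I_m * 'I_m) -> Prop) :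
  (forall x y, (forall s, (s < t)%N -> x s = y s) -> B x -> B y) ->
  [set w | B (fun s => X s w)] =
  \big[setU/set0]_(u <- words _ t | `[< B (nth p0 u) >]) cylinder p0 u.
Proof.
move=> B_eq; rewrite -bigcup_seq_cond; apply/seteqP; split => w /=.
  move=> Bw; pose u := mkseq (fun s => X s w) t.
  have su : size u = t by rewrite size_mkseq.
  exists u => /=.
    rewrite mem_words su eqxx/=; apply/asboolP; apply: B_eq Bw => s st.
    by rewrite nth_mkseq.
  move=> k /=; rewrite su mem_iota/= add0n => kt; by rewrite nth_mkseq.
move=> [u /= /andP[+ /asboolP Bu] wu]; rewrite mem_words => /eqP ut.
apply: B_eq Bu => s st; apply/esym; apply: wu => /=.
by rewrite mem_iota add0n ut.
Qed.

End Law.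

(** * Markov's inequality for weighted words *)

Lemma weighted_markov (R : realFieldType) (I : Type) (s : seq I) (w N : I -> R)
    (c : R) :
  (forall i, 0 <= w i) -> (forall i, 0 <= N i) ->
  c * \sum_(i <- s | c < N i) w i <= \sum_(i <- s) w i * N i.
Proof.
move=> w0 N0; rewrite mulr_sumr big_mkcond; apply: ler_sum => i _.
case: ifP => [/ltW cN|_]; last exact: mulr_ge0.
by rewrite mulrC ler_wpM2l.
Qed.

(** Stands in for Markov's inequality at threshold 0: nonnegative terms with a nonpositive sum
    vanish one by one. *)
Lemma weighted_positive_eq0 (R : realFieldType) (I : Type) (s : seq I)
    (w N : I -> R) :
  (forall i, 0 <= w i) -> (forall i, 0 <= N i) ->
  \sum_(i <- s) w i * N i <= 0 -> \sum_(i <- s | 0 < N i) w i = 0.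
Proof.
move=> w0 N0; elim: s => [|i s IHs]; first by rewrite !big_nil.
have s0 : 0 <= \sum_(j <- s) w j * N j by apply: sumr_ge0 => j _; exact: mulr_ge0.
have i0 : 0 <= w i * N i by exact: mulr_ge0.
rewrite !big_cons => le0.
have wN0 : w i * N i = 0 by lra.
rewrite IHs; last by lra.
case: ifP => // Ni; move/eqP: wN0; rewrite mulf_eq0 (gt_eqF Ni) orbF => /eqP->.
by rewrite addr0.
Qed.

(* If [gap = 0], the bound is [+oo], unless no disagreement is left at time t. *)
Lemma deviation_term_bound (R : realType) (I : Type) (s : seq I) (w N : I -> R)
    (g D0 L sp : R) (m : nat) :
  (0 < m)%N -> (forall i, 0 <= w i) -> (forall i, 0 <= N i) -> 0 <= g ->
  0 <= L -> 0 <= sp -> 0 <= D0 -> D0 <= m%:R * sp ^+ 2 ->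
  \sum_(i <- s) w i * N i <= L * D0 ->
  ((\sum_(i <- s | (g ^+ 2 < 4 * N i)%R) w i)%:E <=
   (4 * m%:R * L)%:E * (sp%:E / g%:E) ^+ 2)%E.
Proof.
move=> m0 w0 N0 g0 L0 sp0 D00 Dsp Nle.
have mR : 0 < m%:R :> R by rewrite ltr0n.
have N40 i : 0 <= 4 * N i by rewrite mulr_ge0.
have Nle4 : \sum_(i <- s) w i * (4 * N i) <= 4 * (L * D0).
  under eq_bigr do rewrite mulrCA; rewrite -mulr_sumr.
  by rewrite ler_wpM2l.
have [g00|gN0] := eqVneq g 0.
  have [LD0|LD0] := leP (L * D0) 0.
    rewrite g00 expr0n/= weighted_positive_eq0//; last by lra.
    by rewrite mule_ge0 ?sqre_ge0// lee_fin !mulr_ge0.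
  have Lgt0 : 0 < L.
    by rewrite lt_neqAle L0 andbT; apply: contraTneq LD0 => <-; rewrite mul0r ltxx.
  have Dgt0 : 0 < D0.
    by rewrite lt_neqAle D00 andbT; apply: contraTneq LD0 => <-; rewrite mulr0 ltxx.
  have spgt0 : 0 < sp.
    rewrite lt_neqAle sp0 andbT; apply: contraTneq Dgt0 => sp00.
    by rewrite -leNgt (le_trans Dsp)// -sp00 expr0n mulr0.
  (* Here [sp / 0] is [+oo] because [0 < sp], and the factor in front is positive. *)
  rewrite g00 inve0 gt0_muley ?lte_fin// expe2 mulyy.
  by rewrite gt0_muley ?leey// lte_fin !mulr_gt0.
have ggt0 : 0 < g by rewrite lt_neqAle eq_sym gN0.
rewrite inver (negPf gN0) expe2 -!EFinM lee_fin.
have := weighted_markov s (g ^+ 2) w0 N40.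
move=> /le_trans /(_ Nle4); rewrite mulrC -ler_pdivlMr ?exprn_gt0//.
move=> /le_trans; apply.
(* The 4 comes from the halved gap squared, and [m] from the bound of [D0] by the spread. *)
have -> : 4 * m%:R * L * (sp / g * (sp / g)) = (4 * (L * (m%:R * sp ^+ 2))) / g ^+ 2.
  by field.
by rewrite ler_wpM2r ?invr_ge0 ?exprn_ge0// ler_wpM2l// ler_wpM2l.
Qed.

(** * Union bound over the objects *)

Lemma edges_neq0 (R : realType) (m : nat) (G : rel 'I_m) (P : 'I_m * 'I_m -> R) :
  \sum_(p in edges G) P p = 1 -> exists p, p \in edges G.
Proof.
move=> Psum; case: (pickP (mem (edges G))) => [p pG|noG]; first by exists p.
by move/eqP: Psum; rewrite big_pred0// eq_sym oner_eq0.
Qed.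

Lemma word_law_edges (R : realType) (m : nat) (G : rel 'I_m)
    (P : 'I_m * 'I_m -> R) p0 u :
  word_law G P u != 0 -> forall s, (s < size u)%N -> nth p0 u s \in edges G.
Proof.
move=> u0 s su; apply: contraNT u0 => pG; rewrite /word_law prodf_seq_eq0.
apply/hasP; exists (nth p0 u s); first exact: mem_nth.
by rewrite /edge_law (negPf pG) eqxx.
Qed.

(** The deviating agent contributes one square to the disagreement, whose center is still
    [average b] since edges preserve the average. *)
Lemma no_consensus_deviation (R : realType) (m n : nat) (G : rel 'I_m)
  (b : 'I_m -> 'rV[R]_n) X t :
  ordered (average b) -> (forall s, (s < t)%N -> X s \in edges G) ->
  ~ is_consensus_time b X t ->
  exists j g, [/\ gap (average b) j = g%:E, 0 <= g &
    g ^+ 2 < 4 * disagreement (gossip b X t) j].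
Proof.
move=> bord XG /existsNP[i /(not_ordered_deviation bord)[j [g [gapE g0 lt_g]]]].
exists j, g; split => //; apply: lt_le_trans lt_g _; rewrite ler_wpM2l//.
rewrite disagreementE (@average_gossip _ _ _ G)// (bigD1 i)//= lerDl.
by apply: sumr_ge0 => k _; exact: sqr_ge0.
Qed.

Theorem theorem26 (R : realType) (m n : nat)
  (G : rel 'I_m) (Gsym : symmetric G) (Girr : irreflexive G)
  (Gconn : forall i i' : 'I_m, connect G i i')
  (P : 'I_m * 'I_m -> R)
  (Ppos : forall p, p \in edges G -> 0 < P p)
  (Psum : \sum_(p in edges G) P p = 1)
  (b : 'I_m -> 'rV[R]_n) (bord : ordered (average b))
  (d : measure_display) (T : measurableType d) (Pr : probability T R)
  (X : nat -> T -> 'I_m * 'I_m)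
  (Xmeas : forall s p, measurable (X s @^-1` [set p]))
  (Xlaw : forall s p, p \in edges G -> Pr (X s @^-1` [set p]) = (P p)%:E)
  (Xind : mutually_independent Pr X)
  (t : nat) :
  (Pr [set w | t%:R%:E < consensus_time b (fun s => X s w)] <=
   (4 * m%:R * lambda2 (gossip_matrix G P) ^+ t)%:E *
     \sum_(j < n) ((spread b j)%:E / gap (average b) j) ^+ 2)%E.
Proof.
have [p0 p0G] := edges_neq0 Psum.
have m_gt1 : (1 < m)%N.
  move: p0G; rewrite inE => /andP[p012 _].
  exact: leq_ltn_trans (leq_ltn_trans (leq0n p0.1) p012) (ltn_ord p0.2).
have m_gt0 : (0 < m)%N := ltnW m_gt1.
(* The state at time [s] depends on the picks before [s], so lateness is decided by the first [t]
   picks. *)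
pose late x := forall s, (s <= t)%N -> ~ is_consensus_time b x s.
have late_eq x y : (forall s, (s < t)%N -> x s = y s) -> late x -> late y.
  move=> xy late_x s st; rewrite /is_consensus_time (@gossip_eq _ _ _ _ _ x).
    exact: late_x.
  by move=> k ks; rewrite xy// (leq_trans ks).
have -> : [set w | (t%:R%:E < consensus_time b (fun s => X s w))%E] =
    [set w | late (fun s => X s w)].
  by apply/seteqP; split => w /consensus_time_gt.
rewrite (bigsetU_cylinder X p0 late_eq).
apply: le_trans (measure_bigsetU_le _ _ _ _) _.
  by move=> u; exact: measurable_cylinder.
rewrite (eq_bigr _ (fun u _ =>
  law_cylinder Psum Xmeas Xlaw Xind p0 u)) sumEFin.
pose w := word_law G P.
have w_ge0 u : 0 <= w u by exact: word_law_ge0.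
pose N j u := disagreement (gossip b (nth p0 u) t) j.
have N_ge0 j u : 0 <= N j u by exact: disagreement_ge0.
(* An infinite gap means that the object has no neighbour; [fine] would turn it into 0, hence the
   explicit exclusion. *)
pose far j u := (gap (average b) j != +oo%E) &&
  (fine (gap (average b) j) ^+ 2 < 4 * N j u).
(* Compared word by word: a late word of nonzero weight uses only edges and is far for some
   object. *)
have late_far : \sum_(u <- words _ t | `[< late (nth p0 u) >]) w u <=
    \sum_j \sum_(u <- words _ t | far j u) w u.
  under [leRHS]eq_bigr do rewrite big_mkcond.
  rewrite exchange_big/= big_mkcond/= big_seq [leRHS]big_seq.
  apply: ler_sum => u; rewrite mem_words => /eqP ut.
  have far_ge0 j : 0 <= (if far j u then w u else 0) by case: ifP.
  case: ifPn => [/asboolP late_u|_]; last by apply: sumr_ge0.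
  have [wu0|wu0] := eqVneq (w u) 0; first by rewrite {1}wu0; apply: sumr_ge0.
  have uG s : (s < t)%N -> nth p0 u s \in edges G.
    by move=> st; apply: word_law_edges wu0 _ _; rewrite ut.
  have [j [g [gapE g0 lt_g]]] :=
    no_consensus_deviation bord uG (late_u _ (leqnn t)).
  rewrite (bigD1 j)//= {1}/far gapE/= lt_g lerDl.
  by apply: sumr_ge0.
apply: le_trans (_ : _ <= (\sum_j \sum_(u <- words _ t | far j u) w u)%:E)%E _.
  by rewrite lee_fin.
rewrite ge0_sume_distrr => [|j _]; last exact: sqre_ge0.
rewrite -sumEFin; apply: lee_sum => j _.
have lam_ge0 := exprn_ge0 t (lambda2_gossip_ge0 m_gt1 Ppos).
rewrite /far; have := gap_ge0 j bord.
case: (gap (average b) j) => [g| |]//; last first.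
  (* Infinite gap: no word is far for [j], and the right side is nonnegative. *)
  rewrite big_pred0 => [_|u]; last by rewrite eqxx.
  by rewrite mule_ge0 ?sqre_ge0// lee_fin !mulr_ge0.
rewrite lee_fin => g_ge0.
apply: (@deviation_term_bound _ _ _ w (N j) g (disagreement b j)) => //.
- exact: spread_ge0.
- exact: disagreement_ge0.
- exact: disagreement_le_spread.
- exact: expected_disagreement.
Qed.
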